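(* Let $X$ be a real normed vector space, $L\subset S_X$ a nonempty closed set, $K\subset X$ a proper closed convex cone, and $M\subset X$ a nonempty set. Suppose that $\operatorname{cone}L\cap(-\operatorname{int}K)\neq\emptyset$. (i) If $\overline{x}\in M$ is a weak directional Pareto minimum for $M$ with respect to $L$, then $$T_B^L(M,\overline{x})\cap(-\operatorname{int}K)=\emptyset .$$ (ii) If for $\overline{x}\in M$ one has $$T_B^L(\operatorname{cl}(M+K),\overline{x})\cap(-\operatorname{int}K)=\emptyset ,$$ then $\overline{x}$ is a weak directional Pareto minimum for $M$ with respect to $L$.
   Context: $S_X$ is the unit sphere of $X$; $\operatorname{cone}C=\{tc\mid t\ge0,\ c\in C\}$; $\operatorname{cl}$ and $\operatorname{int}$ are topological closure and interior. A convex cone $K\subset X$ is proper if $K\neq\{0\}$ and $K\neq X$ (not necessarily pointed). Weak directional Pareto minimum of a set: when $\operatorname{int}K\neq\emptyset$, $\overline{x}\in M$ is a weak directional Pareto minimum for $M$ with respect to $L$ if $(M\cap(\overline{x}+\operatorname{cone}L)-\overline{x})\cap(-\operatorname{int}K)=\emptyset$. Directional Bouligand tangent cone: for nonempty $A\subset X$ and $\overline{x}\in A$, $T_B^L(A,\overline{x})$ is the set of all $u\in X$ for which there are $(u_n)\subset\operatorname{cone}L$ with $u_n\to u$ and $(t_n)\subset(0,\infty)$ with $t_n\to0$ such that $\overline{x}+t_nu_n\in A$ for all $n$. *)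

(* Defs.v *)
From mathcomp Require Import all_boot all_order all_algebra.
From mathcomp Require Import all_classical all_reals all_analysis.

Set Implicit Arguments.
Unset Strict Implicit.
Unset Printing Implicit Defensive.

Import Order.TTheory GRing.Theory Num.Theory.
Import numFieldNormedType.Exports.

Local Open Scope classical_set_scope.
Local Open Scope ring_scope.

Definition unit_sphere (R : realType) (X : normedModType R) : set X :=
  [set x | `|x| = 1].
Arguments unit_sphere {R} X.

Definition cone (R : realType) (X : normedModType R) (C : set X) : set X :=
  [set t *: c | t in [set t : R | 0 <= t] & c in C].

Definition set_add (R : realType) (X : normedModType R) (A B : set X) : set X :=
  [set a + b | a in A & b in B].

Definition set_opp (R : realType) (X : normedModType R) (A : set X) : set X :=
  [set - a | a in A].

Definition translate (R : realType) (X : normedModType R) (x : X) (A : set X)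
  : set X :=
  [set x + a | a in A].

(* Pointedness is not required. *)
Definition proper_convex_cone (R : realType) (X : normedModType R) (K : set X)
  : Prop :=
  [/\ K !=set0,
      (forall (t : R) (k : X), 0 <= t -> K k -> K (t *: k)),
      convex_set K,
      K <> [set 0] & K <> setT].

(* Intended for K with nonempty interior: otherwise every point of M satisfies
   it. *)
Definition weak_directional_Pareto_minimum (R : realType) (X : normedModType R)
  (K L M : set X) (x : X) : Prop :=
  M x /\
  translate (- x) (M `&` translate x (cone L)) `&` set_opp (interior K) = set0.

(* Intended for x in A. *)
Definition directional_Bouligand_tangent_cone (R : realType)
  (X : normedModType R) (L A : set X) (x : X) : set X :=
  [set u | exists (u_ : nat -> X) (t_ : nat -> R),
    [/\ (forall n, cone L (u_ n)),
        u_ @ \oo --> u,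
        (forall n, 0 < t_ n),
        t_ @ \oo --> 0 &
        (forall n, A (x + t_ n *: u_ n))]].

(* Main.v *)
Require Import Defs.
From mathcomp Require Import all_boot all_order all_algebra.
From mathcomp Require Import all_classical all_reals all_analysis.

Import Order.TTheory GRing.Theory Num.Theory.
Import numFieldNormedType.Exports.

Local Open Scope classical_set_scope.
Local Open Scope ring_scope.

(** Both parts move points along rays. For (i), if a tangent vector [u] lay in [- interior K],
    openness would put some [u_ n] there too; since [cone L] and [interior K] are stable under
    positive scaling ([cone_scale], [interior_scale]), the step [t_ n *: u_ n] would violate
    minimality. For (ii), if [x + v] violates minimality, the segment from [x + v] back to [x] runs
    in the direction [- v], which lies in [K], so it stays in [M + K] and makes [v] a tangent vector
    at [x]. *)

Lemma interior_scale (R : realType) (X : normedModType R) (K : set X)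
  (t : R) (k : X) (K_scale : forall (s : R) (y : X), 0 <= s -> K y -> K (s *: y)) :
  0 < t -> interior K k -> interior K (t *: k).
Proof.
move=> t0 Kk.
(* Pull the neighbourhood [K] of [k] back along the continuous map [y |-> t^-1 *: y]; scaling by [t]
   then returns to [y]. *)
have h : (fun y : X => t^-1 *: y) @ (t *: k) --> t^-1 *: (t *: k).
  exact: scaler_continuous.
rewrite scalerA mulVf ?gt_eqF// scale1r in h.
have KV : \forall y \near t *: k, K (t^-1 *: y) := h _ Kk.
rewrite /interior; near=> y.
have /(K_scale t _ (ltW t0)) : K (t^-1 *: y) by near: y.
by rewrite scalerA mulfV ?gt_eqF// scale1r.
Unshelve. all: by end_near.
Qed.

Lemma cone_scale (R : realType) (X : normedModType R) (C : set X)
  (t : R) (v : X) : 0 <= t -> cone C v -> cone C (t *: v).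
Proof.
move=> t0 [s s0 [c Cc <-]]; exists (t * s); first exact: mulr_ge0.
by exists c => //; rewrite scalerA.
Qed.

Theorem theorem4p3 (R : realType) (X : normedModType R) (L K M : set X)
  (L_nonempty : L !=set0) (L_closed : closed L) (L_sphere : L `<=` unit_sphere X)
  (K_cone : proper_convex_cone K) (K_closed : closed K)
  (M_nonempty : M !=set0)
  (LK : cone L `&` set_opp (interior K) !=set0) :
  (forall x : X, M x ->
     weak_directional_Pareto_minimum K L M x ->
     directional_Bouligand_tangent_cone L M x `&` set_opp (interior K) = set0) /\
  (forall x : X, M x ->
     directional_Bouligand_tangent_cone L (closure (set_add M K)) x
       `&` set_opp (interior K) = set0 ->
     weak_directional_Pareto_minimum K L M x).
Proof.
case: K_cone => _ K_scale _ _ _; split=> x Mx.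
- case=> _ x_min; rewrite -subset0 => u [[u_ [t_ [coneu cvu t0 _ Mu]]] [k Kk kE]].
  have cvk : (fun n => - u_ n) @ \oo --> k by rewrite -[k]opprK kE; exact: cvgN.
  have [n Kn] : exists n, interior K (- u_ n).
    by apply: (@filter_ex _ \oo); apply: cvk; apply: nbhs_interior.
  (* The displacement [t_ n *: u_ n] itself is the forbidden point of the intersection. *)
  suff : set0 (t_ n *: u_ n) by []; rewrite -x_min; split.
    exists (x + t_ n *: u_ n); last by rewrite addKr.
    split; first exact: Mu.
    by exists (t_ n *: u_ n) => //; apply: cone_scale => //; exact: ltW.
  exists (t_ n *: (- u_ n)); first exact: interior_scale.
  by rewrite scalerN opprK.
- move=> tangent0; split=> //; rewrite -subset0.
  move=> w [[y [My [v conev yE]] wE] [k Kk kE]]; subst y w.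
  rewrite addKr in kE *; rewrite -tangent0; split; last by exists k.
  (* A constant direction suffices, as [v] is already in [cone L]. The shift to [n.+1] keeps the
     step sizes in [(0, 1]], so that [1 - n.+1%:R^-1] is a nonnegative multiplier of [k]. *)
  exists (fun=> v), (fun n => n.+1%:R^-1); split=> //.
  + exact: cvg_cst.
  + exact: cvg_harmonic.
  + move=> n; apply: subset_closure; exists (x + v) => //.
    exists ((1 - n.+1%:R^-1) *: k).
      apply: K_scale; last exact: interior_subset.
      by rewrite subr_ge0 invf_le1 // ler1n.
    (* [x + t v = (x + v) + (1 - t) k], since [v = - k]. *)
    by rewrite -kE scalerBl scale1r scalerN addrA subrK.
Qed.
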